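(* Let $a_1=a_1(n),a_2=a_2(n)\in\mathbb N$ and $p=p(n)=o(1)$ be such that $1\ll a_2\le a_1$ and $\min\{a_2,a_1-a_2\}\,p\to\infty$ as $n\to\infty$. Let $X_1\in\mathrm{Bin}(a_1,p)$ and $X_2\in\mathrm{Bin}(a_2,p)$ be independent random variables, and let $q=1-p$. Then there exists a constant $\zeta\in(0,1/2)$ such that for any fixed constant $M\in\mathbb R$, $$\mathbb P(X_1-X_2\ge M)\ \ge\ \Phi\Big(\frac{(a_1-a_2)p-M}{\sqrt{(a_1+a_2)pq}}\Big)-\frac{2\zeta}{\sqrt{a_2p}}.$$ In particular, for $n$ large enough, $$\mathbb P(X_1-X_2\ge M)\ \ge\ \frac12+\frac15\min\Big\{1,\frac{(a_1-a_2)p}{\sqrt{(a_1+a_2)p}}\Big\}.$$ Moreover, for any fixed constant $m\in\mathbb Z$, $$\mathbb P(X_1-X_2=m)=o\Big(\mathbb P(X_1-X_2\ge m)-\mathbb P(X_1-X_2<m)\Big)$$ as $n\to\infty$.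
   Context: $\Phi(t)=\int_{-\infty}^t\frac{1}{\sqrt{2\pi}}e^{-x^2/2}\,dx$ is the standard normal cumulative distribution function. $f\ll g$ means $f=o(g)$ as $n\to\infty$. $X\in\mathrm{Bin}(a,p)$ means that $X$ is binomially distributed with parameters $a$ and $p$.
   Formalization: The first inequality is stated for all n large enough (depending on M), since the asymptotic hypotheses leave finitely many n unconstrained and the bound fails there, e.g. a_1=a_2=10, p=1-10^{-6}, M=10^{-4}. *)

(* Defs.v *)
From HB Require Import structures.
From mathcomp Require Import all_boot all_order all_algebra.
From mathcomp Require Import all_classical all_reals all_analysis.

Set Implicit Arguments.
Unset Strict Implicit.
Unset Printing Implicit Defensive.

Import Order.TTheory GRing.Theory Num.Theory.
Import numFieldNormedType.Exports.

Local Open Scope classical_set_scope.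
Local Open Scope ring_scope.

Definition independent_RV d d1 d2 (T : measurableType d)
    (T1 : measurableType d1) (T2 : measurableType d2) (R : realType)
    (P : probability T R) (X : {RV P >-> T1}) (Y : {RV P >-> T2}) : Prop :=
  forall (A : set T1) (B : set T2), measurable A -> measurable B ->
    P (X @^-1` A `&` Y @^-1` B) = (P (X @^-1` A) * P (Y @^-1` B))%E.

(* [binomial_prob n p] is a Dirac mass at 0 when p lies outside [0, 1]: users
   of this predicate must assume 0 <= p <= 1. *)
Definition in_Bin d (T : measurableType d) (R : realType) (P : probability T R)
    (X : {RV P >-> nat}) (n : nat) (p : R) : Prop :=
  forall A : set nat, distribution P X A = binomial_prob n p A.

Definition Phi (R : realType) (t : R) : R :=
  \int[@lebesgue_measure R]_(x in `]-oo, t])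
    ((Num.sqrt (2 * pi))^-1 * expR (- x ^+ 2 / 2)).

(* Main.v *)
Require Import Defs.
From HB Require Import structures.
From mathcomp Require Import all_boot all_order all_algebra.
From mathcomp Require Import all_classical all_reals all_analysis.
From mathcomp Require Import ring lra.

Set Implicit Arguments.
Unset Strict Implicit.
Unset Printing Implicit Defensive.

Import Order.TTheory GRing.Theory Num.Theory.
Import numFieldNormedType.Exports.

Local Open Scope classical_set_scope.
Local Open Scope ring_scope.

(* Stein's method with a zero-bias step. Put S = X1 - X2, mu = E S,
   sigma^2 = Var S, W = (S - mu) / sigma and dl = 1 / sigma. The size-bias
   identity E[X h(X)] = a p E[h(Y + 1)], for X in Bin(a, p) and Y in
   Bin(a - 1, p), expresses E[W f(W)] through unit increments of f. Apply it to
   the solution f of Stein's equation for the half-line [z, +oo[. The function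
   u(w) = w f(w) is nondecreasing, so the increments coming from X1 (upward)
   can only help, and those coming from X2, which carry at most half of the
   variance, cost about dl / 4 * (1 + sqrt (2 pi) / 2). The lattice shift
   z -> z - dl costs another dl / sqrt (2 pi). The total is below 1.14 dl, while
   a1 >= a2 gives 1 / sqrt (a2 p) >= 1.4 dl: hence zeta = 9/20. Clipping S - m
   to [-2, 2] in the same identity gives P(S = m) <= 2 dl. *)

(** * The Gaussian distribution function *)

Lemma is_derive_ge0_le (R : realType) (f df : R -> R) (a b : R) : a <= b ->
  (forall x, a <= x <= b -> is_derive x 1 f (df x)) ->
  (forall x, a <= x <= b -> 0 <= df x) -> f a <= f b.
Proof.
move=> ab fdf df0.
have [y yab|y|c cab fba] := @MVT_segment R f df a b ab.
- by apply: fdf; rewrite !ltW ?(itvP yab).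
- move: y; apply: continuous_in_subspaceT => y; rewrite inE/= in_itv/= => /fdf h.
  exact/differentiable_continuous/derivable1_diffP.
- by rewrite -subr_ge0 fba mulr_ge0 ?subr_ge0// df0// (itvP cab).
Qed.

Lemma is_derive_derive1 (R : realType) (f : R -> R) (x l : R) :
  derivable f x 1 -> derive1 f x = l -> is_derive x 1 f l.
Proof. by move=> df; rewrite derive1E => <-; exact: DeriveDef. Qed.

Section Gauss.
Variable R : realType.
Implicit Types x y z w t : R.

Definition gauss_pdf x : R := (Num.sqrt (2 * pi))^-1 * expR (- x ^+ 2 / 2).

Lemma gauss_pdf_gt0 x : 0 < gauss_pdf x.
Proof. by rewrite mulr_gt0 ?expR_gt0// invr_gt0 sqrtr_gt0 mulr_gt0 ?pi_gt0. Qed.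

Lemma gauss_pdfN x : gauss_pdf (- x) = gauss_pdf x.
Proof. by rewrite /gauss_pdf sqrrN. Qed.

Lemma gauss_pdf_normal_pdf x : gauss_pdf x = normal_pdf 0 1 x.
Proof.
rewrite normal_pdfE ?oner_eq0// /gauss_pdf /normal_peak /normal_fun subr0 expr1n.
by rewrite mul1r -(mulr_natl pi).
Qed.

Lemma Phi_normal_prob x : Phi x = fine (normal_prob 0 1 `]-oo, x]).
Proof.
rewrite /Phi /Rintegral; congr fine; apply: eq_integral => y _.
by rewrite -gauss_pdf_normal_pdf.
Qed.

Lemma continuous_gauss_pdf : continuous gauss_pdf.
Proof.
have -> : gauss_pdf = normal_pdf 0 1 by apply/funext => x; exact: gauss_pdf_normal_pdf.
exact/continuous_normal_pdf/oner_neq0.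
Qed.

Global Instance is_derive_Phi x : is_derive x 1 (@Phi R) (gauss_pdf x).
Proof.
have gi : (@lebesgue_measure R).-integrable `]-oo, (x + 1)] (EFin \o gauss_pdf).
  apply: (@integrableS _ _ _ _ setT) => //.
  have -> : EFin \o gauss_pdf = (fun x => (normal_pdf 0 1 x)%:E).
    by apply/funext => y /=; rewrite gauss_pdf_normal_pdf.
  exact: integrable_normal_pdf.
pose F (y : R) := (\int[@lebesgue_measure R]_(t in `]-oo, y]) gauss_pdf t)%R.
have -> : @Phi R = F by [].
have : derivable F x 1 /\ derive1 F x = gauss_pdf x.
  apply: (@continuous_FTC1 R gauss_pdf -oo%O x (x + 1) _ gi _ (@continuous_gauss_pdf x)).
  - by rewrite ltrDl.
  - by rewrite ltNyr.
by move=> [dF FE]; exact: is_derive_derive1.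
Qed.

Let idR : measurableTypeR R -> R := idfun.

HB.instance Definition _ :=
  @isMeasurableFun.Build _ _ _ _ idR (@measurable_id _ _ setT).

Let idRV : {RV (@normal_prob R 0 1) >-> R} := idR.

Lemma Phi_cdf : @Phi R = fine \o cdf idRV.
Proof. by apply/funext => x; rewrite Phi_normal_prob. Qed.

Lemma Phi_cvgy : Phi x @[x --> +oo] --> (1 : R).
Proof. by rewrite Phi_cdf; exact/fine_cvg/cvg_cdfy1. Qed.

Lemma Phi_cvgNy : Phi x @[x --> -oo] --> (0 : R).
Proof. by rewrite Phi_cdf; exact/fine_cvg/cvg_cdfNy0. Qed.

Lemma Phi_le x y : x <= y -> Phi x <= Phi y.
Proof.
move=> xy; apply: (is_derive_ge0_le xy (fun t _ => is_derive_Phi t)) => t _.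
exact/ltW/gauss_pdf_gt0.
Qed.

Lemma Phi_ge0 x : 0 <= Phi x.
Proof. by rewrite Phi_cdf /= fine_ge0 ?cdf_ge0. Qed.

(** The density is even, so [Phi t + Phi (- t)] has zero derivative; its constant value is read off
    from the limit at +oo. *)
Lemma PhiN x : Phi (- x) = 1 - Phi x.
Proof.
pose h t := Phi t + Phi (- t).
have dh t : is_derive t 1 h 0.
  have d2 : is_derive t 1 (fun t : R => Phi (- t)) (- gauss_pdf t).
    have dN : is_derive t 1 (-%R : R -> R) (-1) by exact: is_deriveNid.
    have := is_derive1_comp (is_derive_Phi (- t)) dN.
    by rewrite gauss_pdfN mulrN1.
  have := is_deriveD (is_derive_Phi t) d2.
  by move/is_derive_eq; apply; rewrite subrr.
have hc a b : h a = h b.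
  by apply: is_derive_0_is_cst.
have h1 : h t @[t --> +oo] --> (1 : R).
  rewrite -[1]addr0; apply: cvgD; first exact: Phi_cvgy.
  by apply: (cvg_comp _ _ _ Phi_cvgNy); exact/cvgNrNy/cvg_id.
have : h t @[t --> +oo] --> h x.
  by rewrite (_ : h = cst (h x)); [exact: cvg_cst|apply/funext => t; exact: hc].
move=> /(cvg_unique _ h1) => /(_ _) hx.
by rewrite hx ?/h 1?addrC ?addKr //; exact: norm_hausdorff.
Qed.

Lemma Phi0 : Phi (0 : R) = 1 / 2.
Proof. by have := PhiN 0; rewrite oppr0; lra. Qed.

Lemma Phi_le1 x : Phi x <= 1.
Proof. by have := Phi_ge0 (- x); rewrite PhiN; lra. Qed.

End Gauss.

(** * Mills ratio inequalities for the Gaussian tail *)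

Section Mills.
Variable R : realType.
Implicit Types x y z w t : R.

Lemma gauss_pdf_neq0 x : gauss_pdf x != 0.
Proof. exact/lt0r_neq0/gauss_pdf_gt0. Qed.

Lemma gauss_pdf_max x : gauss_pdf x <= gauss_pdf 0.
Proof.
rewrite /gauss_pdf ler_pM2l ?invr_gt0 ?sqrtr_gt0 ?mulr_gt0 ?pi_gt0// ler_expR.
by rewrite expr0n/= oppr0 mul0r mulNr oppr_le0 mulr_ge0 ?sqr_ge0 ?invr_ge0.
Qed.

Global Instance is_derive_gauss_pdf x : is_derive x 1 (@gauss_pdf R) (- x * gauss_pdf x).
Proof.
pose k x := - x ^+ 2 / 2 : R.
have dk : is_derive x 1 k (- x).
  have -> : k = (fun t : R => (- 2^-1) * (t ^+ 2)) by apply/funext => t; rewrite /k; field.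
  have d2 : is_derive x 1 (fun t : R => t ^+ 2) (2 * x).
    have := is_deriveM (is_derive_id x (1 : R)) (is_derive_id x (1 : R)).
    by move/is_derive_eq; apply; rewrite /GRing.scale/= mulr1 mulr_natl.
  have := is_deriveZ (- 2^-1) d2.
  by move/is_derive_eq; apply; rewrite /GRing.scale/=; field.
have := is_deriveZ (Num.sqrt (2 * pi))^-1 (is_derive1_comp (is_derive_expR (k x)) dk).
by move/is_derive_eq; apply; rewrite /gauss_pdf /GRing.scale/= /k; ring.
Qed.

(** On the negative axis [L] is nonincreasing and lies below [Phi]. Were it positive at [w], [Phi]
    would stay above [L w] on ]-oo, w], against its limit 0. *)
Lemma mills_upper w : w < 0 -> 0 <= gauss_pdf w + w * Phi w.
Proof.
move=> w0; rewrite leNgt; apply/negP => lt0.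
pose L x := Phi x + gauss_pdf x * x^-1.
have dL x : x < 0 -> is_derive x 1 L (- (gauss_pdf x * x ^- 2)).
  move=> x0.
  have dV : is_derive x 1 (fun t : R => t^-1) (- x ^- 2).
    have := @is_deriveV R id x 1 1 (ltr0_neq0 x0) (is_derive_id x 1).
    by move/is_derive_eq; apply; rewrite /GRing.scale/= mulr1.
  have := is_deriveD (is_derive_Phi x) (is_deriveM (is_derive_gauss_pdf x) dV).
  move/is_derive_eq; apply; rewrite /GRing.scale/=; field.
  by rewrite lt_eqF.
have L_ge x : x <= w -> L w <= L x.
  move=> xw; rewrite -lerN2.
  apply: (@is_derive_ge0_le _ (- L) (fun x => gauss_pdf x * x ^- 2)) => // t /andP[_ tw].
    have := is_deriveN (dL t (le_lt_trans tw w0)).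
    by move/is_derive_eq; apply; rewrite opprK.
  by rewrite mulr_ge0 ?invr_ge0 ?sqr_ge0// ltW ?gauss_pdf_gt0.
have Lw : 0 < L w.
  have -> : L w = (gauss_pdf w + w * Phi w) / w by rewrite /L; field; rewrite lt_eqF.
  by rewrite nmulr_lgt0 ?invr_lt0.
have Phi_ge x : x <= w -> L w <= Phi x.
  move=> xw; apply: (le_trans (L_ge _ xw)).
  rewrite gerDl nmulr_lle0 ?invr_lt0 ?(le_lt_trans xw)//.
  exact/ltW/gauss_pdf_gt0.
near (ninfty_nbhs R)%R => x.
have xw : x <= w by near: x; apply: nbhs_ninfty_le; exact: num_real.
have : Phi x < L w by near: x; exact: (cvgr_lt _ (@Phi_cvgNy R)).
by rewrite ltNge Phi_ge.
Unshelve. all: by end_near. Qed.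

(** After division by [1 + w ^+ 2] the expression is [K w], and [K] is nondecreasing. A negative
    value at [w] would keep [K] away from 0 on ]-oo, w], which the decay of its second term
    excludes. *)
Lemma mills_lower w : 0 <= (1 + w ^+ 2) * Phi w + w * gauss_pdf w.
Proof.
pose q x := (1 + x ^+ 2 : R).
have q0 x : 0 < q x by rewrite ltr_pwDl ?sqr_ge0.
pose K x := Phi x + x * gauss_pdf x * (q x)^-1.
have dK x : is_derive x 1 K (2 * gauss_pdf x * q x ^- 2).
  have d2 : is_derive x 1 (fun t : R => t ^+ 2) (2 * x).
    have := is_deriveM (is_derive_id x (1 : R)) (is_derive_id x (1 : R)).
    by move/is_derive_eq; apply; rewrite /GRing.scale/= mulr1 mulr_natl.
  have dq : is_derive x 1 q (2 * x).
    by have := is_deriveD (is_derive_cst (1 : R) x (1 : R)) d2; rewrite add0r.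
  have q'0 : q x != 0 by rewrite gt_eqF.
  have := is_deriveD (is_derive_Phi x) (is_deriveM
    (is_deriveM (is_derive_id x 1) (is_derive_gauss_pdf x))
    (@is_deriveV _ _ _ _ _ q'0 dq)).
  move/is_derive_eq; apply; rewrite /GRing.scale/= !fctE /q; field.
  exact: q'0.
have K_le x : x <= w -> K x <= K w.
  move=> xw; apply: (is_derive_ge0_le xw (fun t _ => dK t)) => t _.
  by rewrite !mulr_ge0 ?invr_ge0 ?exprn_ge0// ltW ?gauss_pdf_gt0.
suff Kw : 0 <= K w.
  have -> : (1 + w ^+ 2) * Phi w + w * gauss_pdf w = K w * q w.
    by rewrite /K /q; field; rewrite gt_eqF// q0.
  by rewrite mulr_ge0// ltW.
rewrite leNgt; apply/negP => Kw.
(* So negative that [K w * x] exceeds [gauss_pdf 0]; then the second term of [K x] is already above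
   [K w], and [Phi x] is nonnegative. *)
pose x := Num.min w (gauss_pdf 0 / K w - 1).
have xw : x <= w by rewrite ge_min lexx.
have xK : x <= gauss_pdf 0 / K w - 1 by rewrite ge_min lexx orbT.
have gK : gauss_pdf 0 / K w < 0 by rewrite nmulr_llt0 ?gauss_pdf_gt0 ?invr_lt0.
have x0 : x < 0 by apply: (le_lt_trans xK); lra.
have := K_le _ xw; rewrite leNgt => /negP; apply.
have : K w < x * gauss_pdf x * (q x)^-1.
  rewrite ltr_pdivlMr//.
  have h1 : x * gauss_pdf 0 <= x * gauss_pdf x by rewrite ler_nM2l ?gauss_pdf_max.
  apply: lt_le_trans h1.
  have h2 : K w * x >= gauss_pdf 0.
    rewrite [leRHS]mulrC -ler_ndivlMr//; lra.
  have h3 : K w * x * x <= gauss_pdf 0 * x by rewrite ler_nM2r.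
  rewrite /q; nra.
by have := Phi_ge0 x; rewrite /K; lra.
Qed.

End Mills.

(** * The Stein solution of a half-line *)

Section Stein.
Variable R : realType.
Implicit Types x y z w t : R.

Lemma affine_derive_le (G dG : R -> R) (a b x y : R) : x <= y ->
  (forall t, x <= t <= y -> is_derive t 1 G (dG t)) ->
  (forall t, x <= t <= y -> a + b * t <= dG t) ->
  a * (y - x) + b * (y ^+ 2 - x ^+ 2) / 2 <= G y - G x.
Proof.
move=> xy dGE dG_ge.
pose H t := G t - (a * t + b / 2 * (t * t)).
suff : H x <= H y by rewrite /H !expr2; lra.
apply: (@is_derive_ge0_le _ H (fun t => dG t - (a + b * t))) => // t txy; last first.
  by rewrite subr_ge0 dG_ge.
have dtt := is_deriveM (is_derive_id t (1 : R)) (is_derive_id t (1 : R)).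
have da := is_deriveZ a (is_derive_id t (1 : R)).
have db := is_deriveZ (b / 2) dtt.
have := is_deriveB (dGE t txy) (is_deriveD da db).
by move/is_derive_eq; apply; rewrite /GRing.scale/=; field.
Qed.

(** By symmetry, the Mills ratio of the upper tail at [- x]. It solves y' = 1 + x y, Stein's
    equation with a constant right-hand side. *)
Definition mills_ratio x : R := Phi x / gauss_pdf x.

Lemma mills_ratio_ge0 x : 0 <= mills_ratio x.
Proof. by rewrite divr_ge0 ?Phi_ge0// ltW ?gauss_pdf_gt0. Qed.

Global Instance is_derive_mills_ratio x : is_derive x 1 mills_ratio (1 + x * mills_ratio x).
Proof.
have := is_deriveM (is_derive_Phi x) (is_deriveV (gauss_pdf_neq0 x) (is_derive_gauss_pdf x)).
move/is_derive_eq; apply; rewrite /GRing.scale/= /mills_ratio; field.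
exact: gauss_pdf_neq0.
Qed.

Lemma deriv_mills_ratio_ge0 x : 0 <= 1 + x * mills_ratio x.
Proof.
have [x0|x0] := leP 0 x.
  by apply: addr_ge0 => //; apply: mulr_ge0 => //; exact: mills_ratio_ge0.
have -> : 1 + x * mills_ratio x = (gauss_pdf x + x * Phi x) / gauss_pdf x.
  by rewrite /mills_ratio; field; exact: gauss_pdf_neq0.
by rewrite divr_ge0 ?mills_upper// ltW ?gauss_pdf_gt0.
Qed.

Lemma mills_ratio_le x y : x <= y -> mills_ratio x <= mills_ratio y.
Proof.
by move=> xy; apply: (is_derive_ge0_le xy (fun t _ => is_derive_mills_ratio t)) => t _;
  exact: deriv_mills_ratio_ge0.
Qed.

(** The derivative of [t * mills_ratio t] is the quantity of [mills_lower] divided by the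
    density. *)
Lemma mul_mills_ratio_le x y : x <= y -> x * mills_ratio x <= y * mills_ratio y.
Proof.
move=> xy.
have dM t : is_derive t 1 (fun s : R => s * mills_ratio s)
    (mills_ratio t + t * (1 + t * mills_ratio t)).
  have := is_deriveM (is_derive_id t (1 : R)) (is_derive_mills_ratio t).
  by move/is_derive_eq; apply; rewrite /GRing.scale/= mulr1 addrC.
apply: (is_derive_ge0_le xy (fun t _ => dM t)) => t _.
have -> : mills_ratio t + t * (1 + t * mills_ratio t) =
    ((1 + t ^+ 2) * Phi t + t * gauss_pdf t) / gauss_pdf t.
  by rewrite /mills_ratio; field; exact: gauss_pdf_neq0.
by rewrite divr_ge0 ?mills_lower// ltW ?gauss_pdf_gt0.
Qed.

Lemma mills_ratio0 : mills_ratio 0 = Num.sqrt (2 * pi) / 2.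
Proof.
by rewrite /mills_ratio Phi0 /gauss_pdf expr0n/= oppr0 mul0r expR0 mulr1 invrK; lra.
Qed.

(** The branch of the Stein solution to the left of [z]; the right branch is its image under (z, x)
    -> (-z, -x). *)
Definition steinL z x : R := (1 - Phi z) * mills_ratio x.

Lemma steinL_diag z : steinL z z = steinL (- z) (- z).
Proof. by rewrite /steinL /mills_ratio gauss_pdfN PhiN; ring. Qed.

(** For x > 0, lowering [z] to [x] only increases the value, and [steinL_diag] then moves the
    diagonal point to the negative axis, where [mills_ratio] is at most its value at 0. *)
Lemma steinL_le_mills_ratio0 z x : x <= z -> steinL z x <= mills_ratio 0.
Proof.
move=> xz; have [x0|x0] := leP x 0.
  rewrite -[leRHS]mul1r ler_pM ?mills_ratio_ge0 ?mills_ratio_le ?subr_ge0 ?Phi_le1//.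
  by rewrite gerDl oppr_le0 Phi_ge0.
apply: (@le_trans _ _ (steinL x x)).
  by rewrite ler_wpM2r ?mills_ratio_ge0// lerD2l lerN2 Phi_le.
rewrite steinL_diag -[leRHS]mul1r.
rewrite ler_pM ?mills_ratio_ge0 ?mills_ratio_le ?subr_ge0 ?Phi_le1//.
  by rewrite gerDl oppr_le0 Phi_ge0.
by rewrite oppr_le0 ltW.
Qed.

Lemma is_derive_steinL z x :
  is_derive x 1 (steinL z) ((1 - Phi z) * (1 + x * mills_ratio x)).
Proof. exact: (is_deriveZ (1 - Phi z) (is_derive_mills_ratio x)). Qed.

Lemma steinL_le z x y : x <= y -> steinL z x <= steinL z y.
Proof. by move=> xy; rewrite ler_wpM2l ?mills_ratio_le// subr_ge0 Phi_le1. Qed.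

Lemma mul_steinL_le z x y : x <= y -> x * steinL z x <= y * steinL z y.
Proof.
move=> xy; rewrite mulrCA [leRHS]mulrCA.
by rewrite ler_wpM2l ?mul_mills_ratio_le// subr_ge0 Phi_le1.
Qed.

(** For x <= 0 the product [x * mills_ratio x] is nonpositive. For x > 0, [1 - Phi z <= 1 - Phi x]
    and the Mills bound [x * (1 - Phi x) <= gauss_pdf x] leave [1 - Phi z + Phi x], at most 1 as x
    <= z. *)
Lemma deriv_steinL_le1 z x : x <= z -> (1 - Phi z) * (1 + x * mills_ratio x) <= 1.
Proof.
move=> xz; have Pz1 := Phi_le1 z; have Pz0 := Phi_ge0 z.
have [x0|x0] := leP x 0.
  have := deriv_mills_ratio_ge0 x; have := mills_ratio_ge0 x.
  have : x * mills_ratio x <= 0 by rewrite mulr_le0_ge0 ?mills_ratio_ge0.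
  nra.
have xN0 : - x < 0 by rewrite oppr_lt0.
have : (1 - Phi z) * (x * mills_ratio x) <= Phi x.
  apply: (@le_trans _ _ ((1 - Phi x) * (x * mills_ratio x))).
    apply: ler_wpM2r; last by rewrite lerD2l lerN2 Phi_le.
    by apply: mulr_ge0; [exact: ltW|exact: mills_ratio_ge0].
  have -> : (1 - Phi x) * (x * mills_ratio x) = Phi x * (x * (1 - Phi x)) / gauss_pdf x.
    by rewrite /mills_ratio; ring.
  rewrite ler_pdivrMr ?gauss_pdf_gt0// ler_wpM2l ?Phi_ge0//.
  by have := mills_upper xN0; rewrite gauss_pdfN PhiN; lra.
by have := Phi_le xz; lra.
Qed.

Lemma steinL_lip z x y : x <= y -> y <= z -> steinL z y - steinL z x <= y - x.
Proof.
move=> xy yz.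
pose H t := t - steinL z t.
suff : H x <= H y by rewrite /H; lra.
apply: (@is_derive_ge0_le _ H
  (fun t => 1 - (1 - Phi z) * (1 + t * mills_ratio t))) => // t /andP[_ ty].
by rewrite subr_ge0 deriv_steinL_le1// (le_trans ty).
Qed.

(* The bounded solution of f' (w) - w f(w) = 1_(w <= z) - Phi z. *)
Definition stein z w : R := if w <= z then steinL z w else steinL (- z) (- w).

Lemma steinN z w : stein (- z) (- w) = stein z w.
Proof.
rewrite /stein lerN2 !opprK; case: (ltgtP w z) => // ->.
by rewrite -steinL_diag.
Qed.

Lemma stein_le z w : stein z w <= mills_ratio 0.
Proof.
rewrite /stein; case: (leP w z) => wz; apply: steinL_le_mills_ratio0 => //.
by rewrite lerN2 ltW.
Qed.

Lemma stein_left z w : w <= z -> stein z w = steinL z w.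
Proof. by rewrite /stein => ->. Qed.

Lemma stein_right z w : z <= w -> stein z w = steinL (- z) (- w).
Proof. by move=> zw; rewrite -steinN stein_left ?lerN2. Qed.

(** The left branch has slope in [0, 1], the right one follows by symmetry, and an interval
    straddling [z] is cut there. *)
Lemma stein_lip z x y : x <= y -> `|stein z y - stein z x| <= y - x.
Proof.
have left t a b : a <= b -> b <= t -> `|stein t b - stein t a| <= b - a.
  move=> ab bt; rewrite !stein_left// ?(le_trans ab)//.
  by rewrite ger0_norm ?subr_ge0 ?steinL_le// steinL_lip.
have right t a b : a <= b -> t <= a -> `|stein t b - stein t a| <= b - a.
  move=> ab ta; rewrite -(steinN t b) -(steinN t a) distrC.
  have := left (- t) (- b) (- a).
  by rewrite !lerN2 (_ : - a - - b = b - a) => [/(_ ab ta)|]; last ring.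
move=> xy; have [yz|zy] := leP y z; first exact: left.
have [zx|xz] := leP z x; first exact: right.
have := left z x z (ltW xz) (lexx z); have := right z z y (ltW zy) (lexx z).
have := ler_normD (stein z y - stein z z) (stein z z - stein z x).
rewrite (_ : _ - _ + (_ - _) = stein z y - stein z x); last by ring.
lra.
Qed.

Lemma mul_stein_le z x y : x <= y -> x * stein z x <= y * stein z y.
Proof.
have left t a b : a <= b -> b <= t -> a * stein t a <= b * stein t b.
  by move=> ab bt; rewrite !stein_left// ?(le_trans ab)// mul_steinL_le.
have right t a b : a <= b -> t <= a -> a * stein t a <= b * stein t b.
  move=> ab ta; rewrite -(steinN t b) -(steinN t a).
  have := left (- t) (- b) (- a).
  by rewrite !lerN2 => /(_ ab ta); rewrite !mulNr lerN2.
move=> xy; have [yz|zy] := leP y z; first exact: left.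
have [zx|xz] := leP z x; first exact: right.
exact: le_trans (left z x z (ltW xz) (lexx z)) (right z z y (ltW zy) (lexx z)).
Qed.

(* A primitive of w |-> w f(w): the kinks of the two terms cancel at z. *)
Definition stein_prim z w : R := stein z w - (1 - Phi z) * w + Num.max 0 (w - z).

(** On each side of [z] the derivative of [stein_prim z] is [t * stein z t], so an affine lower
    bound for it integrates, over an interval cut at [z] if need be. Slope 0 serves convexity, a
    positive slope the second-order bound. *)
Lemma stein_prim_ge z (a b x y : R) : x <= y ->
  (forall t, x <= t <= y -> a + b * t <= t * stein z t) ->
  a * (y - x) + b * (y ^+ 2 - x ^+ 2) / 2 <= stein_prim z y - stein_prim z x.
Proof.
pose gL t := steinL z t - (1 - Phi z) * t.
pose gR t := steinL (- z) (- t) - ((1 - Phi z) * t - (t - z)).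
have gLE t : t <= z -> stein_prim z t = gL t.
  by move=> tz; rewrite /stein_prim stein_left// max_l ?addr0// subr_le0.
have gRE t : z <= t -> stein_prim z t = gR t.
  move=> tz; rewrite /stein_prim stein_right// max_r ?subr_ge0// /gR.
  by ring.
have dgL t : is_derive t 1 gL (t * steinL z t).
  have := is_deriveB (is_derive_steinL z t)
    (is_deriveZ (1 - Phi z) (is_derive_id t (1 : R))).
  by move/is_derive_eq; apply; rewrite /steinL /GRing.scale/=; ring.
have dgR t : is_derive t 1 gR (t * steinL (- z) (- t)).
  have dN : is_derive t 1 (-%R : R -> R) (-1) by exact: is_deriveNid.
  have d1 := is_derive1_comp (is_derive_steinL (- z) (- t)) dN.
  have d2 := is_deriveB (is_derive_id t (1 : R)) (is_derive_cst z t (1 : R)).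
  have := is_deriveB d1
    (is_deriveB (is_deriveZ (1 - Phi z) (is_derive_id t (1 : R))) d2).
  by move/is_derive_eq; apply; rewrite /steinL PhiN /GRing.scale/=; ring.
have left u v : u <= v -> v <= z ->
    (forall t, u <= t <= v -> a + b * t <= t * stein z t) ->
    a * (v - u) + b * (v ^+ 2 - u ^+ 2) / 2 <= stein_prim z v - stein_prim z u.
  move=> uv vz uvP; rewrite !gLE// ?(le_trans uv)//.
  apply: (affine_derive_le uv (fun t _ => dgL t)) => t tuv.
  by rewrite -stein_left ?uvP//; case/andP: tuv => _ /le_trans; exact.
have right u v : u <= v -> z <= u ->
    (forall t, u <= t <= v -> a + b * t <= t * stein z t) ->
    a * (v - u) + b * (v ^+ 2 - u ^+ 2) / 2 <= stein_prim z v - stein_prim z u.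
  move=> uv zu uvP; rewrite !gRE// ?(le_trans zu)//.
  apply: (affine_derive_le uv (fun t _ => dgR t)) => t tuv.
  by rewrite -stein_right ?uvP//; case/andP: tuv => /(le_trans zu).
move=> xy xyP; have [yz|zy] := leP y z; first exact: left.
have [zx|xz] := leP z x; first exact: right.
have xzP t : x <= t <= z -> a + b * t <= t * stein z t.
  by move=> /andP[xt tz]; apply: xyP; rewrite xt (le_trans tz) ?ltW.
have zyP t : z <= t <= y -> a + b * t <= t * stein z t.
  by move=> /andP[xt tz]; apply: xyP; rewrite tz (le_trans _ xt) ?ltW.
have := left x z (ltW xz) (lexx z) xzP; have := right z y (ltW zy) (lexx z) zyP.
lra.
Qed.

Lemma stein_prim_convex z w t : 0 <= t ->
  t * (w * stein z w) <= stein_prim z (w + t) - stein_prim z w.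
Proof.
move=> t0; have wt : w <= w + t by rewrite lerDl.
have /(stein_prim_ge wt) : forall s, w <= s <= w + t ->
    w * stein z w + 0 * s <= s * stein z s.
  by move=> s /andP[ws _]; rewrite mul0r addr0 mul_stein_le.
by rewrite !mul0r addr0 addrC addKr mulrC.
Qed.

(** Going back from [w], the derivative w f(w) drops at rate at most |w| + [mills_ratio 0]: the
    first part is |w| times the Lipschitz constant of f, the second the uniform upper bound on f. *)
Lemma stein_prim_smooth z w t : 0 <= t ->
  t * (w * stein z w) - t ^+ 2 / 2 * (`|w| + mills_ratio 0) <=
  stein_prim z w - stein_prim z (w - t).
Proof.
move=> t0; have wt : w - t <= w by rewrite gerBl.
pose L := `|w| + mills_ratio 0.
have /(stein_prim_ge wt) : forall s, w - t <= s <= w ->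
    (w * stein z w - w * L) + L * s <= s * stein z s.
  move=> s /andP[_ sw].
  have h1 : w * (stein z w - stein z s) <= `|w| * (w - s).
    apply: le_trans (ler_norm _) _.
    by rewrite normrM ler_wpM2l ?stein_lip.
  have h2 : (w - s) * stein z s <= (w - s) * mills_ratio 0.
    by rewrite ler_wpM2l ?subr_ge0 ?stein_le.
  rewrite /L; lra.
rewrite -/L !expr2; lra.
Qed.

End Stein.

(** * Binomial expectations *)

Section BinomialExpectation.
Variables (R : realType) (p : R).
Implicit Types (a b : nat) (h k : nat -> R).
Local Notation q := (1 - p).

(** The expectation of h(X) for X in Bin(a, p), by conditioning on one trial at a time: identities
    then follow by induction on [a] without binomial coefficients. *)
Fixpoint Ebin a h : R :=
  if a is b.+1 then p * Ebin b (h \o S) + q * Ebin b h else h 0%N.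

Lemma eq_Ebin a h k : h =1 k -> Ebin a h = Ebin a k.
Proof. by move=> /funext ->. Qed.

Lemma EbinD a h k : Ebin a (fun i => h i + k i) = Ebin a h + Ebin a k.
Proof.
elim: a h k => [//|a IH] h k /=.
by rewrite IH (IH (h \o S) (k \o S)); ring.
Qed.

Lemma EbinZ a c h : Ebin a (fun i => c * h i) = c * Ebin a h.
Proof.
elim: a h => [//|a IH] h /=.
by rewrite IH (IH (h \o S)); ring.
Qed.

Lemma Ebin_cst a c : Ebin a (fun=> c) = c.
Proof. by elim: a => [//|a IH] /=; rewrite !IH; ring. Qed.

Lemma Ebin_le a h k : 0 <= p <= 1 -> (forall i, h i <= k i) -> Ebin a h <= Ebin a k.
Proof.
move=> /andP[p0 p1]; elim: a h k => [|a IH] h k hk /=; first exact: hk.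
by apply: lerD; apply: ler_wpM2l; rewrite ?subr_ge0//; apply: IH => i; exact: hk.
Qed.

(** Conditioning on one trial shifts i to i + 1, and [shift] splits the factor i + 1 into i, left to
    the induction, and 1. *)
Lemma Ebin_sizebias a h :
  Ebin a.+1 (fun i => i%:R * h i) = a.+1%:R * p * Ebin a (h \o S).
Proof.
have shift b k : Ebin b ((fun i => i%:R * k i) \o S) =
    Ebin b (fun i => i%:R * (k \o S) i) + Ebin b (k \o S).
  by rewrite -EbinD; apply: eq_Ebin => i /=; rewrite -natr1; ring.
elim: a h => [|a IH] h; first by rewrite /=; ring.
rewrite [LHS]/= -/(Ebin a.+1 _) -/(Ebin a.+1 (fun i => i%:R * h i)) shift !IH /=.
by rewrite -[in RHS]natr1; ring.
Qed.

Lemma Ebin_sum a h : Ebin a h = \sum_(i < a.+1) binomial_pmf a p i * h i.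
Proof.
elim: a h => [|a IH] h.
  by rewrite big_ord1 /binomial_pmf /= !expr0 mulr1 bin0 mulr1n mul1r.
rewrite /= !IH [RHS]big_ord_recl [X in _ = _ + X](eq_bigr (fun i : 'I_a.+1 =>
   p * (binomial_pmf a p i * (h \o S) i) +
   q * (binomial_pmf a p i.+1 * h i.+1))); last first.
  move=> i _; rewrite /binomial_pmf /= /bump /= add1n subSS binS mulrnDr.
  rewrite exprS.
  have [ia|ia] := ltnP i a.
    by rewrite -[in (a - i)%N](subnSK ia) exprS /unstable.onem 
      -2![_ *+ 'C(a, i)]mulr_natr -2![_ *+ 'C(a, i.+1)]mulr_natr; ring.
  by rewrite bin_small// !mulr0n /unstable.onem -2![_ *+ 'C(a, i)]mulr_natr; ring.
rewrite big_split/= -!big_distrr/= addrCA; congr (_ + _).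
rewrite [in LHS]big_ord_recl [in RHS]big_ord_recr/=.
have -> : binomial_pmf a p a.+1 = 0 by rewrite /binomial_pmf bin_small// mulr0n.
rewrite mul0r addr0 mulrDr; congr (_ + _).
by rewrite /binomial_pmf !bin0 !mulr1n expr0 !subn0 exprS /unstable.onem; ring.
Qed.

End BinomialExpectation.

(** * Expectations for a difference of two independent binomials *)

Section DifferenceExpectation.
Variables (R : realType) (p : R).
Implicit Types (a b : nat) (h k : R -> R) (c : R).
Local Notation q := (1 - p).

Definition Ediff a b h : R := Ebin p a (fun i => Ebin p b (fun j => h (i%:R - j%:R))).

Lemma EdiffD a b h k : Ediff a b (fun s => h s + k s) = Ediff a b h + Ediff a b k.
Proof. by rewrite /Ediff -EbinD; apply: eq_Ebin => i; rewrite -EbinD. Qed.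

Lemma EdiffZ a b c h : Ediff a b (fun s => c * h s) = c * Ediff a b h.
Proof. by rewrite /Ediff -EbinZ; apply: eq_Ebin => i; rewrite -EbinZ. Qed.

Lemma EdiffB a b h k : Ediff a b (fun s => h s - k s) = Ediff a b h - Ediff a b k.
Proof.
rewrite -mulN1r -EdiffZ -EdiffD; congr Ediff; apply/funext => s.
by rewrite mulN1r.
Qed.

Lemma Ediff_cst a b c : Ediff a b (fun=> c) = c.
Proof. by rewrite /Ediff -[RHS](Ebin_cst p a); apply: eq_Ebin => i; rewrite Ebin_cst. Qed.

Lemma Ediff_le a b h k : 0 <= p <= 1 ->
  (forall s, h s <= k s) -> Ediff a b h <= Ediff a b k.
Proof. by move=> p01 hk; apply: Ebin_le => // i; apply: Ebin_le. Qed.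

Lemma EdiffSl a b h :
  Ediff a.+1 b h = p * Ediff a b (fun s => h (s + 1)) + q * Ediff a b h.
Proof.
rewrite /Ediff/=; congr (_ * _ + _); apply: eq_Ebin => i /=; apply: eq_Ebin => j.
by rewrite -natr1 addrAC.
Qed.

Lemma EdiffSr a b h :
  Ediff a b.+1 h = p * Ediff a b (fun s => h (s - 1)) + q * Ediff a b h.
Proof.
rewrite /Ediff/= EbinD !EbinZ; congr (_ * _ + _); apply: eq_Ebin => i /=.
by apply: eq_Ebin => j; rewrite /= -natr1 opprD addrA.
Qed.

Lemma Ediff_stein a b h :
  Ediff a.+1 b.+1 (fun s => (s - (a.+1%:R - b.+1%:R) * p) * h s) =
  a.+1%:R * p * q * Ediff a b.+1 (fun s => h (s + 1) - h s) +
  b.+1%:R * p * q * Ediff a.+1 b (fun s => h s - h (s - 1)).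
Proof.
rewrite !EdiffB.
have El : Ebin p a.+1 (fun i => Ebin p b.+1 (fun j => i%:R * h (i%:R - j%:R))) =
    a.+1%:R * p * Ediff a b.+1 (fun s => h (s + 1)).
  rewrite (eq_Ebin _ _ (fun i => EbinZ _ _ _ _)) Ebin_sizebias; congr (_ * _).
  apply: eq_Ebin => i /=; congr (_ * _ + _ * _); apply: eq_Ebin => j;
    by rewrite /= -[i.+1%:R]natr1 addrAC.
have Er : Ebin p a.+1 (fun i => Ebin p b.+1 (fun j => j%:R * h (i%:R - j%:R))) =
    b.+1%:R * p * Ediff a.+1 b (fun s => h (s - 1)).
  rewrite /Ediff -EbinZ; apply: eq_Ebin => i.
  rewrite (Ebin_sizebias _ _ (fun j => h (i%:R - j%:R))); congr (_ * _).
  by apply: eq_Ebin => j; rewrite /= -[j.+1%:R]natr1 opprD addrA.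
have -> : Ediff a.+1 b.+1 (fun s => (s - (a.+1%:R - b.+1%:R) * p) * h s) =
    a.+1%:R * p * Ediff a b.+1 (fun s => h (s + 1)) -
    b.+1%:R * p * Ediff a.+1 b (fun s => h (s - 1)) -
    (a.+1%:R - b.+1%:R) * p * Ediff a.+1 b.+1 h.
  suff : a.+1%:R * p * Ediff a b.+1 (fun s => h (s + 1)) =
      Ediff a.+1 b.+1 (fun s => (s - (a.+1%:R - b.+1%:R) * p) * h s) +
      b.+1%:R * p * Ediff a.+1 b (fun s => h (s - 1)) +
      (a.+1%:R - b.+1%:R) * p * Ediff a.+1 b.+1 h by move=> ->; ring.
  rewrite -El -Er -EdiffZ /Ediff -!EbinD; apply: eq_Ebin => i.
  by rewrite -!EbinD; apply: eq_Ebin => j; ring.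
have hl := EdiffSl a b.+1 h; have hr := EdiffSr a.+1 b h.
(* The mean is split between the two counts. Expanding the full expectation along the trial removed
   from each count turns both differences into unit increments with a factor [q]. *)
transitivity (
  a.+1%:R * p * (Ediff a b.+1 (fun s => h (s + 1)) - Ediff a.+1 b.+1 h)
  - b.+1%:R * p * (Ediff a.+1 b (fun s => h (s - 1)) - Ediff a.+1 b.+1 h)); first by ring.
by rewrite {1}hl hr; ring.
Qed.

End DifferenceExpectation.

(** * The lower Berry-Esseen bound for a difference of binomials *)

Section BerryEsseen.
Variables (R : realType) (p : R) (a b : nat).
Hypotheses (p0 : 0 < p) (p1 : p < 1).
Local Notation q := (1 - p).
Local Notation mu := ((a.+1%:R - b.+1%:R) * p).
Local Notation s2 := ((a.+1%:R + b.+1%:R) * p * q).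
Local Notation dl := (Num.sqrt s2)^-1.

Let p01 : 0 <= p <= 1. Proof. by rewrite !ltW. Qed.
Let q0 : 0 < q. Proof. by rewrite subr_gt0. Qed.
Let V1 := a.+1%:R * p * q.
Let V2 := b.+1%:R * p * q.
Let V1_gt0 : 0 < V1. Proof. by rewrite !mulr_gt0 ?ltr0Sn. Qed.
Let V2_gt0 : 0 < V2. Proof. by rewrite !mulr_gt0 ?ltr0Sn. Qed.
Let VE : V1 + V2 = s2. Proof. by rewrite /V1 /V2; ring. Qed.
Let s2_gt0 : 0 < s2. Proof. by rewrite -VE addr_gt0. Qed.
Let dl_gt0 : 0 < dl. Proof. by rewrite invr_gt0 sqrtr_gt0. Qed.
Let dl2 : dl ^+ 2 * s2 = 1.
Proof. by rewrite exprVn sqr_sqrtr ?ltW// mulVf// gt_eqF. Qed.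

Let mix_le (x y z : R) : x <= z -> y <= z -> p * x + q * y <= z.
Proof.
move=> xz yz; have := ler_wpM2l (ltW p0) xz; have := ler_wpM2l (ltW q0) yz.
by lra.
Qed.
Let mix_ge (x y z : R) : z <= x -> z <= y -> z <= p * x + q * y.
Proof.
move=> xz yz; have := ler_wpM2l (ltW p0) xz; have := ler_wpM2l (ltW q0) yz.
by lra.
Qed.

(** [E0] is the full law; [E1] and [E2] lack one trial of X1 and of X2 respectively, as on the right
    of the Stein identity. *)
Let E0 := Ediff p a.+1 b.+1.
Let E1 := Ediff p a b.+1.
Let E2 := Ediff p a.+1 b.
Let E0l h : E0 h = p * E1 (fun s => h (s + 1)) + q * E1 h.
Proof. exact: EdiffSl. Qed.
Let E0r h : E0 h = p * E2 (fun s => h (s - 1)) + q * E2 h.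
Proof. exact: EdiffSr. Qed.

Lemma Ediff_variance : E0 (fun s => (s - mu) ^+ 2) = s2.
Proof.
have -> : (fun s : R => (s - mu) ^+ 2) =
          (fun s => (s - mu) * (s - mu)) by apply/funext => s; rewrite expr2.
rewrite /E0 (Ediff_stein p a b (fun s => s - mu)) -VE /V1 /V2.
congr (_ + _); rewrite -[RHS]mulr1; congr (_ * _).
  by rewrite -[RHS](Ediff_cst p a b.+1); congr Ediff; apply/funext => s; ring.
by rewrite -[RHS](Ediff_cst p a.+1 b); congr Ediff; apply/funext => s; ring.
Qed.

Let norm_le (w : R) : `|w| <= 2^-1 + 2^-1 * w ^+ 2.
Proof.
rewrite -[w ^+ 2]real_normK ?num_real//.
have := sqr_ge0 (`|w| - 1); rewrite !expr2; lra.
Qed.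

Let W s := (s - mu) * dl.
(** Since [q * E1 h <= E0 h] for nonnegative [h], and likewise for [E2], dropping a trial leaves the
    second moment of [W] at most [q^-1]; by [norm_le], [m] then bounds E|W|. *)
Let m := (1 + q^-1) / 2.

Let E0W2 : E0 (fun s => W s ^+ 2) = 1.
Proof.
have -> : (fun s => W s ^+ 2) = (fun s => dl ^+ 2 * (s - mu) ^+ 2).
  by apply/funext => s; rewrite /W exprMn mulrC.
by rewrite /E0 EdiffZ -/E0 Ediff_variance.
Qed.

Let E_norm_le a' b' : q * Ediff p a' b' (fun s => W s ^+ 2) <= 1 ->
  Ediff p a' b' (fun s => `|W s|) <= m.
Proof.
move=> h; apply: le_trans (Ediff_le a' b' p01 (fun s => norm_le (W s))) _.
rewrite EdiffD Ediff_cst EdiffZ /m.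
move: h; rewrite mulrC -ler_pdivlMr// mul1r; lra.
Qed.

Let E1_norm : E1 (fun s => `|W s|) <= m.
Proof.
apply: E_norm_le; rewrite -[leRHS]E0W2 E0l lerDr mulr_ge0 ?(ltW p0)//.
rewrite -(Ediff_cst p a b.+1 0); apply: Ediff_le => // s; exact: sqr_ge0.
Qed.

Let E2_norm : E2 (fun s => `|W s|) <= m.
Proof.
apply: E_norm_le; rewrite -[leRHS]E0W2 E0r lerDr mulr_ge0 ?(ltW p0)//.
rewrite -(Ediff_cst p a.+1 b 0); apply: Ediff_le => // s; exact: sqr_ge0.
Qed.

Let W1 s : W (s + 1) = W s + dl. Proof. by rewrite /W; ring. Qed.
Let WN1 s : W (s - 1) = W s - dl. Proof. by rewrite /W; ring. Qed.

(** The clipped [h] is bounded by 2, yet its increments just before and just after [t] are 1. So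
    E[(S - mu) h(S)] is at least [s2] times the point mass and at most 2 E|S - mu|, itself at most
    twice the standard deviation. *)
Lemma Ediff_point_le (t : R) : E0 (fun s => (s == t)%:R) <= 2 * dl.
Proof.
pose h (s : R) := Num.max (-2) (Num.min 2 (s - t)).
have h_le s : `|h s| <= 2.
  rewrite /h ler_norml le_max lexx ge_max ge_min lexx /= andbT; lra.
have hE s : [\/ s - t <= -2 /\ h s = -2, -2 <= s - t <= 2 /\ h s = s - t
    | 2 <= s - t /\ h s = 2].
  rewrite /h; have [le2|lt2] := leP 2 (s - t).
    by apply: Or33; split=> //; rewrite max_r//; lra.
  by have [leN2|ltN2] := leP (s - t) (-2); [apply: Or31|apply: Or32]; split; lra.
have hS s : (s == t)%:R + (s + 1 == t)%:R <= h (s + 1) - h s.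
  have := hE s; have := hE (s + 1).
  by have [->|st] := eqVneq s t; have [e2|_] := eqVneq (_ + 1) t;
    rewrite ?mulr1n ?mulr0n => -[[? ->]|[? ->]|[? ->]] [[? ->]|[? ->]|[? ->]]; lra.
have hP s : (s == t)%:R + (s - 1 == t)%:R <= h s - h (s - 1).
  by have := hS (s - 1); rewrite subrK addrC.
have ge0 a' b' r : 0 <= Ediff p a' b' (fun s => (s == r)%:R).
  by rewrite -(Ediff_cst p a' b' 0); apply: Ediff_le.
(* Conditioning on the removed trial makes the point mass a mixture of the two indicators in [hS]
   (resp. [hP]), hence at most their sum. *)
have low : s2 * E0 (fun s => (s == t)%:R) <= E0 (fun s => (s - mu) * h s).
  rewrite /E0 Ediff_stein -/E0 -VE mulrDl.
  apply: lerD; apply: ler_wpM2l; rewrite ?(ltW V1_gt0) ?(ltW V2_gt0)//.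
    apply: le_trans (Ediff_le a b.+1 p01 hS); rewrite EdiffD E0l.
    have : 0 <= E1 (fun s => (s + 1 == t)%:R).
      by rewrite -(Ediff_cst p a b.+1 0); apply: Ediff_le.
    have := ge0 a b.+1 t; rewrite -/E1 => h1 h2.
    by apply: mix_le; rewrite -/E1; lra.
  apply: le_trans (Ediff_le a.+1 b p01 hP); rewrite EdiffD E0r.
  have : 0 <= E2 (fun s => (s - 1 == t)%:R).
    by rewrite -(Ediff_cst p a.+1 b 0); apply: Ediff_le.
  have := ge0 a.+1 b t; rewrite -/E2 => h1 h2.
  by apply: mix_le; rewrite -/E2; lra.
have up : E0 (fun s => (s - mu) * h s) <= 2 * Num.sqrt s2.
  apply: (@le_trans _ _ (E0 (fun s => 2 * Num.sqrt s2 * (2^-1 + 2^-1 * W s ^+ 2)))).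
    apply: Ediff_le => // s.
    have -> : s - mu = Num.sqrt s2 * W s by rewrite /W [RHS]mulrC divfK ?sqrtr_eq0 -?ltNge.
    apply: le_trans (ler_norm _) _; rewrite 2!normrM (ger0_norm (sqrtr_ge0 _)).
    rewrite (mulrC 2) -!mulrA ler_wpM2l ?sqrtr_ge0// mulrC.
    by apply: ler_pM => //; exact: norm_le.
  rewrite /E0 EdiffZ EdiffD Ediff_cst EdiffZ -/E0 E0W2.
  by rewrite mulr1 (_ : 2^-1 + 2^-1 = 1) ?mulr1//; lra.
rewrite ler_pdivlMr ?sqrtr_gt0//.
rewrite -(ler_pM2r (_ : 0 < Num.sqrt s2)) ?sqrtr_gt0//.
rewrite -[leLHS]mulrA -expr2 sqr_sqrtr ?(ltW s2_gt0)// mulrC.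
exact: le_trans low up.
Qed.

Let pos_incr (x y : R) : x <= y ->
  Num.max 0 y - Num.max 0 x <= (y - x) * (0 <= y)%R%:R.
Proof.
move=> xy; have [y0|y0] := leP 0 y; rewrite ?mulr1 ?mulr0.
  by have [x0|x0] := leP 0 x; lra.
by rewrite max_l ?subrr// (le_trans xy) ?ltW.
Qed.

(** In the error, the quotient is the share of X2 in the variance: half of it is the curvature loss
    at the increments of X2, while [p] pays for comparing the full law with [E1]. The last factor
    bounds the mean rate of variation of w f(w). *)
Lemma Ediff_ge_Phi_stein (M : R) :
  Phi ((mu - M) * dl - dl) -
  dl * (b.+1%:R / (a.+1%:R + b.+1%:R) / 2 + p) * (m + mills_ratio (0 : R))
  <= E0 (fun s => (M <= s)%R%:R).
Proof.
(* This makes [z <= W s + dl] equivalent to [M <= s]. Dropping a trial of X2 can raise S by one; the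
   extra [dl] keeps both reduced tail probabilities below the true one. *)
pose z := (M - mu) * dl + dl.
have -> : (mu - M) * dl - dl = - z by rewrite /z; ring.
rewrite PhiN.
pose c := mills_ratio (0 : R).
pose f w := stein z w.
pose u w := w * f w.
have uS w t : 0 <= t -> u (w + t) - u w <= t * (`|w| + c).
  move=> t0; have wt : w <= w + t by rewrite lerDl.
  have h1 : w * (f (w + t) - f w) <= `|w| * t.
    apply: le_trans (ler_norm _) _; rewrite normrM ler_wpM2l//.
    by have := stein_lip z wt; rewrite addrAC subrr add0r.
  have h2 : t * f (w + t) <= t * c by rewrite ler_wpM2l ?stein_le.
  rewrite /u; lra.
(* [f] is [stein_prim] plus a linear term minus a positive part; convexity handles the upward
   increment without second-order loss. *)
have fS w : dl * (u w + (1 - Phi z) - (z <= w + dl)%R%:R) <= f (w + dl) - f w.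
  have := stein_prim_convex z w (ltW dl_gt0).
  rewrite /stein_prim -/(f w) -/(f (w + dl)) -/(u w).
  have : Num.max 0 (w + dl - z) - Num.max 0 (w - z) <= dl * (z <= w + dl)%R%:R.
    have := @pos_incr (w - z) (w + dl - z).
    by rewrite lerD2r lerDl subr_ge0 (ltW dl_gt0) (_ : _ - (w - z) = dl); [exact|ring].
  lra.
(* Downwards convexity has the wrong sign, whence the second-order loss of [stein_prim_smooth]. *)
have fP w : dl * (u w - dl / 2 * (`|w| + c) + (1 - Phi z) - (z <= w)%R%:R) <=
    f w - f (w - dl).
  have := stein_prim_smooth z w (ltW dl_gt0).
  rewrite /stein_prim -/(f w) -/(f (w - dl)) -/(u w) -/c.
  have : Num.max 0 (w - z) - Num.max 0 (w - dl - z) <= dl * (z <= w)%R%:R.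
    have := @pos_incr (w - dl - z) (w - z).
    by rewrite lerD2r gerBl subr_ge0 (ltW dl_gt0) (_ : _ - (w - dl - z) = dl); [exact|ring].
  lra.
pose P := E0 (fun s => (M <= s)%R%:R).
pose Eu := E0 (fun s => u (W s)).
have zW s : (z <= W s + dl) = (M <= s).
  by rewrite /z /W lerD2r ler_pM2r// lerD2r.
have ind_le (x y : R) : x <= y -> (M <= x)%R%:R <= (M <= y)%R%:R :> R.
  by move=> xy; rewrite ler_nat; case: (leP M x) => // /le_trans ->.
have P1 : E1 (fun s => (z <= W s + dl)%R%:R) <= P.
  have -> : (fun s => (z <= W s + dl)%R%:R : R) = (fun s => (M <= s)%R%:R).
    by apply/funext => s; rewrite zW.
  rewrite /P E0l.
  have : E1 (fun s => (M <= s)%R%:R) <= E1 (fun s => (M <= s + 1)%R%:R).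
    by apply: Ediff_le => // s; apply: ind_le; rewrite lerDl.
  by move=> h; exact: mix_ge.
have P2 : E2 (fun s => (z <= W s)%R%:R) <= P.
  have -> : (fun s => (z <= W s)%R%:R : R) = (fun s => (M <= s - 1)%R%:R).
    by apply/funext => s; rewrite -zW WN1 subrK.
  rewrite /P E0r.
  have : E2 (fun s => (M <= s - 1)%R%:R) <= E2 (fun s => (M <= s)%R%:R).
    by apply: Ediff_le => // s; apply: ind_le; rewrite gerBl.
  by move=> h; apply: mix_ge.
(* The trial missing in [E1] succeeds with probability [p], and then raises [u] by at most
   [dl * (m + c)] on average. *)
have Eu1 : Eu <= E1 (fun s => u (W s)) + p * (dl * (m + c)).
  rewrite /Eu E0l.
  have : E1 (fun s => u (W (s + 1)) - u (W s)) <= dl * (m + c).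
    apply: le_trans (_ : E1 (fun s => dl * (`|W s| + c)) <= _).
      by apply: Ediff_le => // s; rewrite W1 uS// ltW.
    by rewrite /E1 EdiffZ EdiffD Ediff_cst ler_pM2l// lerD2r.
  rewrite /E1 EdiffB -/E1 => /(ler_wpM2l (ltW p0)); lra.
(* A success of the trial missing in [E2] lowers S, and [u] is nondecreasing: no loss. *)
have Eu2 : Eu <= E2 (fun s => u (W s)).
  rewrite /Eu E0r.
  have : E2 (fun s => u (W (s - 1))) <= E2 (fun s => u (W s)).
    by apply: Ediff_le => // s; rewrite WN1 mul_stein_le// gerBl ltW.
  by move=> h; exact: mix_le.
have A1 : dl * (E1 (fun s => u (W s)) + (1 - Phi z) - P) <=
    E1 (fun s => f (W (s + 1)) - f (W s)).
  apply: (@le_trans _ _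
    (E1 (fun s => dl * (u (W s) + (1 - Phi z) - (z <= W s + dl)%R%:R)))).
    rewrite /E1 EdiffZ EdiffB EdiffD Ediff_cst ler_pM2l// lerD2l lerN2.
    exact: P1.
  by apply: Ediff_le => // s; rewrite W1 fS.
have A2 : dl * (E2 (fun s => u (W s)) - dl / 2 * (m + c) + (1 - Phi z) - P) <=
    E2 (fun s => f (W s) - f (W (s - 1))).
  apply: (@le_trans _ _ (E2 (fun s => dl * (u (W s) - dl / 2 * (`|W s| + c)
      + (1 - Phi z) - (z <= W s)%R%:R)))).
    rewrite /E2 EdiffZ EdiffB EdiffD EdiffB EdiffZ EdiffD !Ediff_cst.
    rewrite ler_pM2l//; apply: lerD; last by rewrite lerN2; exact: P2.
    rewrite lerD2r lerD2l lerN2 ler_pM2l ?divr_gt0// lerD2r.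
    exact: E2_norm.
  by apply: Ediff_le => // s; rewrite WN1 fP.
have EuE : Eu = dl * (V1 * E1 (fun s => f (W (s + 1)) - f (W s)) +
                      V2 * E2 (fun s => f (W s) - f (W (s - 1)))).
  rewrite -[RHS]/(dl * (_ + _)) -(Ediff_stein p a b (fun s => f (W s))) -EdiffZ.
  by congr Ediff; apply/funext => s; rewrite /u /W; ring.
have {A1} A1 : V1 * (dl * (Eu - p * (dl * (m + c)) + (1 - Phi z) - P)) <=
    V1 * E1 (fun s => f (W (s + 1)) - f (W s)).
  rewrite ler_pM2l//; apply: le_trans A1; rewrite ler_pM2l//; lra.
have {A2} A2 : V2 * (dl * (Eu - dl / 2 * (m + c) + (1 - Phi z) - P)) <=
    V2 * E2 (fun s => f (W s) - f (W (s - 1))).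
  rewrite ler_pM2l//; apply: le_trans A2; rewrite ler_pM2l//; lra.
have := lerD A1 A2; rewrite -(ler_pM2l dl_gt0) -EuE.
set r := b.+1%:R / (a.+1%:R + b.+1%:R).
have V2E : V2 * dl ^+ 2 = r.
  have -> : V2 = r * s2 by rewrite /r /V2 !mulrA divfK// -natrD pnatr_eq0.
  by rewrite -[LHS]mulrA [X in r * X]mulrC dl2 mulr1.
have V1E : V1 * dl ^+ 2 = 1 - r.
  have -> : V1 = s2 - V2 by rewrite -VE addrK.
  by rewrite mulrBl V2E mulrC dl2.
(* The [p] loss carries the weight [1 - r]; this nonnegative term rounds the weight up to 1. *)
have mc : 0 <= p * (r * (dl * (m + c))).
  rewrite mulr_ge0 ?(ltW p0)// mulr_ge0 ?divr_ge0 ?addr_ge0//.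
  rewrite mulr_ge0 ?(ltW dl_gt0)// addr_ge0 ?mills_ratio_ge0// divr_ge0// addr_ge0//.
  by rewrite invr_ge0 ltW.
rewrite (_ : dl * (_ + _) =
  (V1 * dl ^+ 2) * (Eu - p * (dl * (m + c)) + (1 - Phi z) - P) +
  (V2 * dl ^+ 2) * (Eu - dl / 2 * (m + c) + (1 - Phi z) - P)); last by ring.
rewrite V1E V2E -/c -/P; lra.
Qed.

End BerryEsseen.

(** * The law of a difference of binomials *)

Lemma binomial_prob_Ebin (R : realType) (n : nat) (p : R) (U : set nat) :
  0 <= p <= 1 -> binomial_prob n p U = (Ebin p n (fun k => (k \in U)%:R))%:E.
Proof.
move=> /andP[p0 p1]; rewrite (@binomial_probE _ n p p0 p1) Ebin_sum -sumEFin.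
by apply: eq_bigr => i _; rewrite diracE -EFinM.
Qed.

Lemma Ebin0 (R : realType) (n : nat) (p : R) (h : nat -> R) :
  (forall k, (k <= n)%N -> h k = 0) -> Ebin p n h = 0.
Proof.
move=> h0; rewrite Ebin_sum big1// => i _; rewrite h0 ?mulr0//.
by rewrite -ltnS.
Qed.

Section JointLaw.
Context d (T : measurableType d) (R : realType) (P : probability T R).
Variables (X1 X2 : {RV P >-> nat}) (a1 a2 : nat) (p : R).
Hypotheses (p01 : 0 <= p <= 1).
Hypotheses (hX1 : in_Bin X1 a1 p) (hX2 : in_Bin X2 a2 p).
Hypothesis hX12 : independent_RV X1 X2.

Let mX (X : {RV P >-> nat}) (A : set nat) : measurable (X @^-1` A).
Proof. by rewrite -[X @^-1` A]setTI; exact: measurable_funPT. Qed.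

(** Independence factorises each slice X1 = i, and the slices with i <= a1 exhaust the event up to
    the null set X1 > a1. *)
Lemma prob_joint_Bin (r : nat -> nat -> bool) :
  P [set w | r (X1 w) (X2 w)] =
  (Ebin p a1 (fun i => Ebin p a2 (fun j => (r i j)%:R)))%:E.
Proof.
pose B i := X1 @^-1` [set i] `&` X2 @^-1` [set j | r i j].
have mB i : measurable (B i) by exact: measurableI.
have BE i : P (B i) = (binomial_pmf a1 p i * Ebin p a2 (fun j => (r i j)%:R))%:E.
  rewrite hX12// EFinM; congr (_ * _)%E.
    have -> : P (X1 @^-1` [set i]) = distribution P X1 [set i] by [].
    rewrite hX1 binomial_prob_Ebin// Ebin_sum; congr EFin.
    have [ia|ai] := leqP i a1; last first.
      rewrite big1 => [|k _]; first by rewrite /binomial_pmf bin_small.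
      rewrite memNset ?mulr0//= => ki; move: (ltn_ord k).
      by rewrite ltnS leqNgt ki ai.
    rewrite (bigD1 (inord i))//= big1 => [|k ki].
      by rewrite inordK ?ltnS// mem_set// mulr1 addr0.
    rewrite memNset ?mulr0//= => ki'; case/eqP: ki.
    by apply/val_inj; rewrite /= inordK ?ltnS.
  have -> : P (X2 @^-1` [set j | r i j]) = distribution P X2 [set j | r i j] by [].
  rewrite hX2 binomial_prob_Ebin//; congr EFin; apply: eq_Ebin => j.
  by rewrite mem_setE.
have mA : measurable [set w | r (X1 w) (X2 w)].
  rewrite (_ : mkset _ = \bigcup_i B i); first exact: bigcup_measurable.
  apply/seteqP; split=> [w /= rw|w [i _ [/= <-]]//].
  by exists (X1 w).
have tB : trivIset setT B.
  apply/trivIsetP => i j _ _ /eqP ij; rewrite -subset0 => w [[/= ei _] [/= ej _]].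
  by apply: ij; rewrite -ei.
have PB : P (\big[setU/set0]_(i < a1.+1) B i) =
    (Ebin p a1 (fun i => Ebin p a2 (fun j => (r i j)%:R)))%:E.
  rewrite measure_bigsetU// Ebin_sum -sumEFin.
  by apply: eq_bigr => i _; exact: BE.
rewrite -PB; apply/eqP; rewrite eq_le; apply/andP; split; last first.
  apply: le_measure; rewrite ?inE//; first exact: bigsetU_measurable.
  by rewrite -bigcup_mkord => w [i _ [/= <-]].
have P0 : P (X1 @^-1` [set k | (a1 < k)%N]) = 0%E.
  rewrite -[LHS]/(distribution P X1 [set k | (a1 < k)%N]).
  rewrite hX1 binomial_prob_Ebin// Ebin0// => k ka.
  by rewrite memNset//= ltnNge ka.
rewrite -[leRHS]adde0 -P0.
have mU : measurable (\big[setU/set0]_(i < a1.+1) B i) by exact: bigsetU_measurable.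
apply: le_trans (measureU2 P mU (mX _ _)).
apply: le_measure; rewrite ?inE//; first exact: measurableU.
move=> w /= rw; have [wa|aw] := leqP (X1 w) a1; last by right.
by left; rewrite -bigcup_mkord; exists (X1 w).
Qed.

End JointLaw.

(** * Numerical bounds *)

Section Numerics.
Variable R : realType.
Implicit Types x y : R.

(** Follows from 2 <= pi < 4, as the square of 17/6 is just above 8. *)
Lemma sqrt_2pi_bounds : 2 <= Num.sqrt (2 * pi : R) <= 17 / 6.
Proof.
have pi2 := pi_ge2 R; have pi4 : pi < 4 :> R by have := pihalf_lt2 R; lra.
have s0 := sqrtr_ge0 (2 * pi : R).
have s2 : Num.sqrt (2 * pi : R) ^+ 2 = 2 * pi by rewrite sqr_sqrtr//; lra.
by apply/andP; split; rewrite -ler_sqr ?nnegrE// ?s2; lra.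
Qed.

Lemma mills_ratio0_le : mills_ratio (0 : R) <= 17 / 12.
Proof. by rewrite mills_ratio0; have /andP[] := sqrt_2pi_bounds; lra. Qed.

Lemma gauss_pdf0_le : gauss_pdf (0 : R) <= 1 / 2.
Proof.
rewrite /gauss_pdf expr0n/= oppr0 mul0r expR0 mulr1 div1r.
have /andP[h _] := sqrt_2pi_bounds.
by rewrite lef_pV2 ?posrE// (lt_le_trans _ h).
Qed.

(** exp(-1/2) is the fourth power of exp(-1/8) >= 7/8. The excess of 51/250 over 1/5 leaves room for
    the error terms of [Ediff_ge_half]. *)
Lemma gauss_pdf1_ge : 51 / 250 <= gauss_pdf (1 : R).
Proof.
have /andP[h1 h2] := sqrt_2pi_bounds.
have e8 : (7 / 8) ^+ 4 <= expR (- (1 : R) ^+ 2 / 2).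
  have -> : - (1 : R) ^+ 2 / 2 = - (1 / 8) * 4%:R by rewrite expr1n; lra.
  have h : 7 / 8 <= expR (- (1 / 8) : R).
    by apply: le_trans (expR_ge1Dx _); lra.
  rewrite expRM_natr; apply: lerXn2r => //; rewrite nnegrE ?expR_ge0//; lra.
have s0 : 0 < Num.sqrt (2 * pi : R) by exact: lt_le_trans h1.
rewrite /gauss_pdf [leRHS]mulrC ler_pdivlMr//; apply: le_trans e8.
by apply: le_trans (ler_wpM2l _ h2) _; [lra|rewrite !exprS expr0; lra].
Qed.

Lemma Phi_lip x y : x <= y -> Phi y - Phi x <= 1 / 2 * (y - x).
Proof.
move=> xy.
pose H (t : R) := 1 / 2 * t - Phi t.
suff : H x <= H y by rewrite /H; lra.
apply: (@is_derive_ge0_le _ H (fun t => 1 / 2 - gauss_pdf t)) => // t _.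
  have := is_deriveB (is_deriveZ (1 / 2) (is_derive_id t (1 : R))) (is_derive_Phi t).
  by move/is_derive_eq; apply; rewrite /GRing.scale/= mulr1.
by rewrite subr_ge0 (le_trans (gauss_pdf_max t))// gauss_pdf0_le.
Qed.

Lemma Phi_ge_half x : 0 <= x -> 1 / 2 + 51 / 250 * Num.min 1 x <= Phi x.
Proof.
move=> x0; have small y : 0 <= y -> y <= 1 -> 1 / 2 + 51 / 250 * y <= Phi y.
  move=> y0 y1.
  pose H (t : R) := Phi t - 51 / 250 * t.
  suff : H 0 <= H y by rewrite /H Phi0; lra.
  apply: (@is_derive_ge0_le _ H (fun t => gauss_pdf t - 51 / 250)) => // t /andP[t0 ty].
    have := is_deriveB (is_derive_Phi t) (is_deriveZ (51 / 250) (is_derive_id t (1 : R))).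
    by move/is_derive_eq; apply; rewrite /GRing.scale/= mulr1.
  rewrite subr_ge0 (le_trans gauss_pdf1_ge)//.
  rewrite /gauss_pdf ler_pM2l ?invr_gt0 ?sqrtr_gt0 ?mulr_gt0 ?pi_gt0// ler_expR.
  rewrite ler_pM2r// lerN2 lerXn2r ?nnegrE//; exact: le_trans ty y1.
have [x1|x1] := leP 1 x; last exact: small (ltW x1).
by apply: le_trans (Phi_le x1); apply: small.
Qed.

End Numerics.

(** * Explicit constants for small p *)

Section QuantitativeBounds.
Variables (R : realType) (a1 a2 : nat) (p : R).
Hypotheses (a2_gt0 : (0 < a2)%N) (a21 : (a2 <= a1)%N).
Hypotheses (p0 : 0 < p) (p100 : p <= 1 / 100).
Local Notation D := ((a1%:R - a2%:R) * p).
Local Notation s := (Num.sqrt ((a1%:R + a2%:R) * p)).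
Local Notation sigma := (Num.sqrt ((a1%:R + a2%:R) * p * (1 - p))).
Local Notation Pge M := (Ediff p a1 a2 (fun t => (M <= t)%R%:R)).
Local Notation Peq m := (Ediff p a1 a2 (fun t => (t == m)%:R)).

Let a1_gt0 : (0 < a1)%N. Proof. exact: leq_trans a21. Qed.
Let p1 : p < 1. Proof. by move: p0 p100; lra. Qed.
Let a2R : 1 <= a2%:R :> R. Proof. by rewrite ler1n. Qed.
Let a21R : a2%:R <= a1%:R :> R. Proof. by rewrite ler_nat. Qed.
Let s_gt0 : 0 < s.
Proof. by rewrite sqrtr_gt0 mulr_gt0//; have := a2R; have := a21R; lra. Qed.
Let sigmaE : sigma = s * Num.sqrt (1 - p).
Proof.
by rewrite sqrtrM// mulr_ge0 ?(ltW p0)//; have := a2R; have := a21R; lra.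
Qed.
Let q_ge : 99 / 100 <= Num.sqrt (1 - p).
Proof.
have pp0 := p0; have pp := p100; have q0 : 0 <= 1 - p by lra.
by rewrite -ler_sqr ?nnegrE ?sqrtr_ge0// ?sqr_sqrtr//; rewrite ?expr2; lra.
Qed.
Let q_le : Num.sqrt (1 - p) <= 1.
Proof.
have pp0 := p0; have pp := p100; have q0 : 0 <= 1 - p by lra.
by rewrite -ler_sqr ?nnegrE ?sqrtr_ge0// ?sqr_sqrtr// expr1n; lra.
Qed.
Let sigma_gt0 : 0 < sigma.
Proof. by rewrite sigmaE mulr_gt0// (lt_le_trans _ q_ge)//; lra. Qed.

Lemma sigma_inv_le : sigma^-1 <= 51 / 50 * s^-1.
Proof.
have hq := q_ge; rewrite sigmaE invfM mulrC ler_pM2r ?invr_gt0//.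
by rewrite -[leRHS]invrK lef_pV2 ?posrE; lra.
Qed.

(** X2 carries at most half of the variance and p <= 1/100, so the error coefficient is at most (1/4
    + 1/100) ((1 + 100/99)/2 + 17/12), just below 16/25. *)
Lemma Ediff_ge_Phi (M : R) : Phi ((D - M) / sigma - sigma^-1) - 16 / 25 / sigma <= Pge M.
Proof.
have := @Ediff_ge_Phi_stein R p a1.-1 a2.-1 p0 p1 M.
rewrite !prednK//; have pp0 := p0; have pp := p100.
have g2 := a2R; have g21 := a21R; apply: le_trans; rewrite lerD2l lerN2.
rewrite -[leLHS]mulrA [leRHS]mulrC ler_pM2l ?invr_gt0//.
have h1 : a2%:R / (a1%:R + a2%:R) <= 1 / 2 :> R by rewrite ler_pdivrMr; lra.
have h2 : (1 - p)^-1 <= 100 / 99.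
  by rewrite -[leRHS]invrK lef_pV2 ?posrE; lra.
have h3 := mills_ratio0_le R; have h4 := mills_ratio_ge0 (0 : R).
have h5 : 0 <= (1 - p)^-1 by rewrite invr_ge0; lra.
apply: (@le_trans _ _ ((1 / 2 / 2 + 1 / 100) * ((1 + 100 / 99) / 2 + 17 / 12))); last lra.
have h6 : 0 <= a2%:R / (a1%:R + a2%:R) :> R by rewrite divr_ge0//; lra.
by apply: ler_pM; lra.
Qed.

(** By [Phi_lip] the lattice shift costs at most half of [sigma^-1], so 57/50 in all; and a1 >= a2
    gives sigma^2 >= 2 (99/100) a2 p. *)
Lemma Ediff_ge_BerryEsseen (M : R) :
  Phi ((D - M) / sigma) - 2 * (9 / 20) / Num.sqrt (a2%:R * p) <= Pge M.
Proof.
apply: le_trans (Ediff_ge_Phi M).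
have pp0 := p0; have pp := p100; have g2 := a2R; have g21 := a21R.
have sN : (D - M) / sigma - sigma^-1 <= (D - M) / sigma.
  by rewrite gerBl invr_ge0 ltW.
have := Phi_lip sN; set X := Phi _; set Y := Phi _ => XY.
suff : 57 / 50 / sigma <= 2 * (9 / 20) / Num.sqrt (a2%:R * p) by lra.
have t0 : 0 < Num.sqrt (a2%:R * p) by rewrite sqrtr_gt0 mulr_gt0//; lra.
rewrite ler_pdivrMr// mulrAC ler_pdivlMr//.
rewrite -ler_sqr ?nnegrE ?mulr_ge0 ?(ltW t0) ?(ltW sigma_gt0)//; try lra.
rewrite !exprMn !sqr_sqrtr ?mulr_ge0 ?(ltW p0)//; try lra.
have h : 0 <= (a1%:R - a2%:R) * p by rewrite mulr_ge0//; lra.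
have h' : 0 <= a2%:R * p by rewrite mulr_ge0//; lra.
have : (a1%:R + a2%:R) * p * (99 / 100) <= (a1%:R + a2%:R) * p * (1 - p).
  by rewrite ler_wpM2l//; [lra|lra].
by rewrite !expr2; lra.
Qed.

(** Here the lattice shift stays inside [Phi]: together with M it takes at most D/200 from the
    drift. The slope (51/250)(199/200), less 29/10000 for the error, still exceeds 1/5. *)
Lemma Ediff_ge_half (M : R) : 300 <= s -> 300 <= D -> 200 * (M + 1) <= D ->
  1 / 2 + 1 / 5 * Num.min 1 (D / s) <= Pge M.
Proof.
move=> s300 D300 DM; have pp0 := p0; have pp := p100; apply: le_trans (Ediff_ge_Phi M).
have sV : s^-1 <= sigma^-1.
  by rewrite lef_pV2 ?posrE// sigmaE ler_piMr// ltW.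
have sV0 : 0 < s^-1 by rewrite invr_gt0.
have x_ge : 199 / 200 * (D / s) <= (D - M) / sigma - sigma^-1.
  have -> : (D - M) / sigma - sigma^-1 = (D - M - 1) / sigma by ring.
  by rewrite mulrA; apply: ler_pM; lra.
have y0 : 0 <= D / s by rewrite divr_ge0 ?(ltW s_gt0)//; lra.
have x0 : 0 <= (D - M) / sigma - sigma^-1 by lra.
have := Phi_ge_half x0.
have min_ge : 199 / 200 * Num.min 1 (D / s) <= Num.min 1 ((D - M) / sigma - sigma^-1).
  have [m1 m2] : Num.min 1 (D / s) <= 1 /\ Num.min 1 (D / s) <= D / s.
    by rewrite !ge_min !lexx orbT.
  by rewrite le_min; apply/andP; split; lra.
have err : 16 / 25 / sigma <= 29 / 10000 * Num.min 1 (D / s).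
  have e1 : 16 / 25 / sigma <= 82 / 125 * s^-1 by have := sigma_inv_le; lra.
  have e2 : 300 / s <= Num.min 1 (D / s).
    by rewrite le_min ler_pdivrMr// mul1r s300 ler_pM2r.
  by lra.
lra.
Qed.

Lemma Ediff_eq_le (m : R) : Peq m <= 51 / 25 / s.
Proof.
have := @Ediff_point_le R p a1.-1 a2.-1 p0 p1 m; rewrite !prednK// => /le_trans; apply.
have := sigma_inv_le; lra.
Qed.

End QuantitativeBounds.

(** * Passage to the limit *)

Theorem lemma2p3 (R : realType) (a1 a2 : nat -> nat) (p : nat -> R)
    (d : nat -> measure_display) (T : forall n, measurableType (d n))
    (P : forall n, probability (T n) R)
    (X1 X2 : forall n, {RV (P n) >-> nat})
    (hp01 : forall n, 0 <= p n <= 1)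
    (hp : p =o_\oo (fun=> 1 : R))
    (ha2 : (fun=> 1 : R) =o_\oo (fun n => (a2 n)%:R : R))
    (ha21 : forall n, (a2 n <= a1 n)%N)
    (hmin : (fun n => (minn (a2 n) (a1 n - a2 n))%:R * p n) @ \oo --> +oo)
    (hX1 : forall n, in_Bin (X1 n) (a1 n) (p n))
    (hX2 : forall n, in_Bin (X2 n) (a2 n) (p n))
    (hX12 : forall n, independent_RV (X1 n) (X2 n)) :
  [/\ exists2 zeta : R, 0 < zeta < 1 / 2 &
        forall M : R, \forall n \near \oo,
          Phi ((((a1 n)%:R - (a2 n)%:R) * p n - M) /
               Num.sqrt (((a1 n)%:R + (a2 n)%:R) * p n * (1 - p n)))
          - 2 * zeta / Num.sqrt ((a2 n)%:R * p n)
          <= fine (P n [set w | M <= (X1 n w)%:R - (X2 n w)%:R]),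
      forall M : R, \forall n \near \oo,
        1 / 2 + 1 / 5 * Num.min 1 (((a1 n)%:R - (a2 n)%:R) * p n /
                          Num.sqrt (((a1 n)%:R + (a2 n)%:R) * p n))
        <= fine (P n [set w | M <= (X1 n w)%:R - (X2 n w)%:R])
    & forall m : int,
        (fun n => fine (P n [set w | (X1 n w)%:Z - (X2 n w)%:Z = m]))
        =o_\oo
        (fun n => fine (P n [set w | m <= (X1 n w)%:Z - (X2 n w)%:Z])
                  - fine (P n [set w | (X1 n w)%:Z - (X2 n w)%:Z < m]))].
Proof.
have p0 n : 0 <= p n by case/andP: (hp01 n).
have small : \forall n \near \oo, p n <= 1 / 100.
  have /eqoP/(_ (1 / 100)) := hp; rewrite divr_gt0// => /(_ isT).
  by apply: filterS => n; rewrite normr1 mulr1; exact/le_trans/ler_norm.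
clear hp ha2.
have large K : \forall n \near \oo, [/\ (0 < a2 n)%N, 0 < p n, p n <= 1 / 100,
    K <= (a2 n)%:R * p n & K <= ((a1 n)%:R - (a2 n)%:R) * p n].
  have /cvgryPge hlarge := hmin.
  near=> n.
  (* The 1 in the maximum forces [a2 n] and [p n] to be nonzero. *)
  have minK : Num.max 1 K <= (minn (a2 n) (a1 n - a2 n))%:R * p n.
    by near: n; exact: hlarge.
  have pn : p n <= 1 / 100 by near: n.
  have max1 : 1 <= Num.max 1 K by rewrite le_max lexx.
  have maxK : K <= Num.max 1 K by rewrite le_max lexx orbT.
  have m2 : (minn (a2 n) (a1 n - a2 n))%:R * p n <= (a2 n)%:R * p n.
    by rewrite ler_wpM2r// ler_nat geq_minl.
  have m1 : (minn (a2 n) (a1 n - a2 n))%:R * p n <= ((a1 n)%:R - (a2 n)%:R) * p n.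
    by rewrite ler_wpM2r// -natrB// ler_nat geq_minr.
  have a2p : 1 <= (a2 n)%:R * p n by lra.
  split=> //; try lra.
    by rewrite lt0n; apply/eqP => a20; move: a2p; rewrite a20 mul0r; lra.
  rewrite lt_neqAle p0 andbT; apply/eqP => pn0; move: a2p; rewrite -pn0 mulr0; lra.
have PgeE n (M : R) : fine (P n [set w | M <= (X1 n w)%:R - (X2 n w)%:R]) =
    Ediff (p n) (a1 n) (a2 n) (fun t => (M <= t)%R%:R).
  by rewrite (prob_joint_Bin (hp01 n) (hX1 n) (hX2 n) (hX12 n)
    (fun i j => M <= i%:R - j%:R)).
have sqrt_ge K n : 0 <= K -> K ^+ 2 <= (a2 n)%:R * p n ->
    K <= Num.sqrt (((a1 n)%:R + (a2 n)%:R) * p n).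
  move=> K0 Ka2; rewrite -(ger0_norm K0) -sqrtr_sqr ler_wsqrtr//.
  by apply: le_trans Ka2 _; rewrite ler_wpM2r// lerDr.
have half (M : R) : \forall n \near \oo,
    1 / 2 + 1 / 5 * Num.min 1 (((a1 n)%:R - (a2 n)%:R) * p n /
      Num.sqrt (((a1 n)%:R + (a2 n)%:R) * p n))
    <= fine (P n [set w | M <= (X1 n w)%:R - (X2 n w)%:R]).
  (* As (a1 + a2) p >= a2 p, the square makes its root at least 300; the sum also covers both
     requirements on the drift (a1 - a2) p. *)
  have := large (300 ^+ 2 + `|200 * (M + 1)|); apply: filterS => n [a2n pn pn' h1 h2].
  have n0 := normr_ge0 (200 * (M + 1)); have n1 := ler_norm (200 * (M + 1)).
  rewrite PgeE; apply: Ediff_ge_half => //.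
  - by apply: sqrt_ge; rewrite // (le_trans _ h1)// lerDl.
  - by apply: le_trans h2; rewrite expr2; lra.
  - by apply: le_trans h2; rewrite expr2; lra.
split; first 2 last.
- move=> m; apply/eqoP => e e0.
  near=> n.
  have ge_half : 1 / 2 + 1 / 5 * Num.min 1 (((a1 n)%:R - (a2 n)%:R) * p n /
      Num.sqrt (((a1 n)%:R + (a2 n)%:R) * p n))
      <= fine (P n [set w | m%:~R <= (X1 n w)%:R - (X2 n w)%:R :> R]).
    by near: n; exact: half.
  (* These bounds make both [s] and [D] at least [6 / e], so that 6/s is at most e times the minimum
     of 1 and D/s. *)
  have [a2n pn pn' h1 h2] : [/\ (0 < a2 n)%N, 0 < p n, p n <= 1 / 100,
    (6 / e) ^+ 2 + 6 / e <= (a2 n)%:R * p n &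
    (6 / e) ^+ 2 + 6 / e <= ((a1 n)%:R - (a2 n)%:R) * p n].
    by near: n; exact: large.
  have intE w : (X1 n w)%:R - (X2 n w)%:R = ((X1 n w)%:Z - (X2 n w)%:Z)%:~R :> R.
    by rewrite intrB.
  have -> : [set w | m <= (X1 n w)%:Z - (X2 n w)%:Z] =
      [set w | m%:~R <= (X1 n w)%:R - (X2 n w)%:R :> R].
    by apply/seteqP; split=> w /=; rewrite intE ler_int.
  have -> : fine (P n [set w | (X1 n w)%:Z - (X2 n w)%:Z < m]) =
      1 - Ediff (p n) (a1 n) (a2 n) (fun t => (m%:~R <= t)%R%:R).
    have -> : [set w | (X1 n w)%:Z - (X2 n w)%:Z < m] =
        [set w | (X1 n w)%:R - (X2 n w)%:R < m%:~R :> R].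
      by apply/seteqP; split=> w /=; rewrite intE ltr_int.
    rewrite (prob_joint_Bin (hp01 n) (hX1 n) (hX2 n) (hX12 n)
      (fun i j => i%:R - j%:R < m%:~R)).
    rewrite -[X in X - _](Ediff_cst (p n) (a1 n) (a2 n)) -EdiffB /=.
    apply: eq_Ebin => i; apply: eq_Ebin => j.
    by rewrite ltNge; case: (_ <= _); rewrite ?subrr ?subr0.
  have -> : fine (P n [set w | (X1 n w)%:Z - (X2 n w)%:Z = m]) =
      Ediff (p n) (a1 n) (a2 n) (fun t => (t == m%:~R)%:R).
    have -> : [set w | (X1 n w)%:Z - (X2 n w)%:Z = m] =
        [set w | (X1 n w)%:R - (X2 n w)%:R == m%:~R :> R].
      apply/seteqP; split=> w /=; rewrite intE eqr_int; first by move=> ->.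
      by move/eqP.
    by rewrite (prob_joint_Bin (hp01 n) (hX1 n) (hX2 n) (hX12 n)
      (fun i j => i%:R - j%:R == m%:~R)).
  move: ge_half; rewrite PgeE.
  set Q := Ediff _ _ _ _; set E := Ediff _ _ _ _ => ge_half.
  have E0 : 0 <= E.
    by rewrite -(Ediff_cst (p n) (a1 n) (a2 n) 0) Ediff_le.
  have EU := Ediff_eq_le a2n (ha21 n) pn pn' m%:~R; rewrite -/E in EU.
  have e6 : 0 < 6 / e by rewrite divr_gt0.
  have e6' := sqr_ge0 (6 / e).
  have s6 : 6 / e <= Num.sqrt (((a1 n)%:R + (a2 n)%:R) * p n).
    by apply: sqrt_ge; lra.
  move: h2 ge_half EU s6; set s := Num.sqrt _.
  set D := ((a1 n)%:R - (a2 n)%:R) * p n => h2 ge_half EU s6.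
  have s0 : 0 < s by lra.
  have min_ge : 6 / e / s <= Num.min 1 (D / s).
    by rewrite le_min ler_pdivrMr// mul1r s6 ler_pM2r ?invr_gt0//; lra.
  have {}min_ge : 6 / s <= e * Num.min 1 (D / s).
    by rewrite [leRHS]mulrC -ler_pdivrMr// mulrAC.
  have iv : 0 < s^-1 by rewrite invr_gt0.
  rewrite (ger0_norm E0); apply: le_trans EU _.
  (* The gap between the two probabilities is 2Q - 1, at least 2/5 of the minimum; the point mass
     fits because 51/25 <= 6 (2/5). *)
  apply: le_trans (_ : e * (2 / 5 * Num.min 1 (D / s)) <= _); first lra.
  rewrite ler_pM2l//; apply: le_trans (ler_norm _); lra.
- exists (9 / 20); first by apply/andP; split; lra.
  move=> M; have := large 0; apply: filterS => n [a2n pn pn' _ _].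
  by rewrite PgeE; exact: Ediff_ge_BerryEsseen.
- exact: half.
Unshelve. all: by end_near. Qed.
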